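(* Let $y\in\mathbb{R}^p$. For any $\lambda>0$ and any integer $k>0$, the vector $\hat\beta_{k+1}$ generated by the Bregman Iterations in the orthogonal design case is given component-wise, for $j\in\{1,\dots,p\}$, by $$(\hat\beta_{k+1})_j=\mathrm{FT}\Big(y,\frac{\lambda}{k+1},\frac{k+1}{k}\Big)_j=\begin{cases}(k+1)\,\mathrm{ST}\big(y_j,\frac{\lambda}{k+1}\big), & |y_j|\le\frac{\lambda}{k},\\ y_j, & |y_j|>\frac{\lambda}{k}.\end{cases}$$
   Context: Orthogonal design case: $n=p$, $X=I_p$, and the $1/n$ factor is dropped. Bregman Iterations with parameter $\lambda>0$: start with $\hat\rho_0=\hat\beta_0=0\in\mathbb{R}^p$ and for $k\ge1$ set $\hat\beta_k=\arg\min_{\beta\in\mathbb{R}^p}\frac12\|y-\beta\|_2^2+\lambda D^{\hat\rho_{k-1}}(\beta,\hat\beta_{k-1})$ and $\hat\rho_k=\hat\rho_{k-1}+\frac1\lambda(y-\hat\beta_k)$, where $D^{\rho}(z,w)=\|z\|_1-\|w\|_1-\langle\rho,z-w\rangle$ for $\rho\in\partial\|w\|_1$ is the Bregman divergence of the $\ell_1$-norm (each $\hat\rho_k$ is a subgradient of $\|\cdot\|_1$ at $\hat\beta_k$). Soft-thresholding: $\mathrm{ST}(u,\mu)=\mathrm{sign}(u)(|u|-\mu)_+$ for $u\in\mathbb{R}$, with $(t)_+=\max(t,0)$ (so $\mathrm{ST}(0,\mu)=0$). Firm-thresholding for $\mu>0,\gamma>1$: $\mathrm{FT}(y,\mu,\gamma)_j=\frac{\gamma}{\gamma-1}\mathrm{ST}(y_j,\mu)$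 if $|y_j|\le\mu\gamma$ and $=y_j$ if $|y_j|>\mu\gamma$. *)

(* Defs.v *)
From mathcomp Require Import all_boot all_order all_algebra.
From mathcomp Require Import reals.

Set Implicit Arguments.
Unset Strict Implicit.
Unset Printing Implicit Defensive.

Import Order.TTheory GRing.Theory Num.Theory.
Local Open Scope ring_scope.

Definition dotv (R : realType) (p : nat) (u v : 'rV[R]_p) : R :=
  \sum_(j < p) u ord0 j * v ord0 j.

Definition l1norm (R : realType) (p : nat) (v : 'rV[R]_p) : R :=
  \sum_(j < p) `|v ord0 j|.

Definition l2norm (R : realType) (p : nat) (v : 'rV[R]_p) : R :=
  Num.sqrt (\sum_(j < p) v ord0 j ^+ 2).

Definition is_argmin (R : realType) (p : nat) (f : 'rV[R]_p -> R)
    (x : 'rV[R]_p) : Prop :=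
  forall z : 'rV[R]_p, f x <= f z.

(* The formula is total in rho; it is the Bregman divergence of the l1-norm
   when rho is a subgradient of the l1-norm at w.  Along the iterations below
   this is automatic (0 is a subgradient at 0, and optimality of beta k.+1
   makes rho k.+1 a subgradient at beta k.+1), so it is not required. *)
Definition bregman_div (R : realType) (p : nat) (rho z w : 'rV[R]_p) : R :=
  l1norm z - l1norm w - dotv rho (z - w).

(* Orthogonal design: X = I_p, with the factor 1/n dropped. *)
Definition bregman_objective (R : realType) (p : nat) (lambda : R)
    (y rho w beta : 'rV[R]_p) : R :=
  2^-1 * l2norm (y - beta) ^+ 2 + lambda * bregman_div rho beta w.

(* The argmin is a relation, so existence and uniqueness of the minimizers
   are not built into the definition. *)
Definition bregman_iterations (R : realType) (p : nat) (lambda : R)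
    (y : 'rV[R]_p) (beta rho : nat -> 'rV[R]_p) : Prop :=
  [/\ beta 0%N = 0, rho 0%N = 0 &
   forall k : nat,
     is_argmin (bregman_objective lambda y (rho k) (beta k)) (beta k.+1) /\
     rho k.+1 = rho k + lambda^-1 *: (y - beta k.+1)].

Definition soft_threshold (R : realType) (u mu : R) : R :=
  Num.sg u * Num.max (`|u| - mu) 0.

Definition firm_threshold (R : realType) (p : nat) (y : 'rV[R]_p)
    (mu gamma : R) : 'rV[R]_p :=
  \row_(j < p) (if `|y ord0 j| <= mu * gamma
                then gamma / (gamma - 1) * soft_threshold (y ord0 j) mu
                else y ord0 j).

(* Main.v *)
Require Import Defs.
From mathcomp Require Import all_boot all_order all_algebra.
From mathcomp Require Import reals.
From mathcomp Require Import ring lra.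

(** Each step is coordinatewise soft-thresholding of [y + lambda * rho] at
    level [lambda], and [lambda * rho] is then updated to what the thresholding
    removed, i.e. to the clipping of [y + lambda * rho] to [[-lambda, lambda]].
    Starting from 0 and always adding the same [y], clipping at each step is
    the same as clipping once at the end, so [lambda * rho k] is the clipping
    of [k * y], and beta k.+1 thresholds [y] plus this clipping. *)

Set Implicit Arguments.
Unset Strict Implicit.
Unset Printing Implicit Defensive.

Import Order.TTheory GRing.Theory Num.Theory.
Local Open Scope ring_scope.

Definition clip (R : realType) (l u : R) : R :=
  if l < u then l else if u < - l then - l else u.

Lemma soft_threshold_clip (R : realType) (l u : R) :
  0 < l -> soft_threshold u l = u - clip l u.
Proof.
move=> l0; rewrite /soft_threshold /clip.
case: (sgrP u) => hu; rewrite /Num.max; do ?[case: ifP => ?]; lra.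
Qed.

Lemma clip_norm_le (R : realType) (l u : R) : 0 < l -> `|clip l u| <= l.
Proof. by move=> l0; rewrite ler_norml /clip; do ?[case: ifP => ?]; lra. Qed.

(** Where thresholding leaves something nonzero, the clip has saturated at [l] or [- l] with the
    same sign. With [clip_norm_le], this makes [clip l u / l] a subgradient of the absolute value at
    the thresholded point. *)
Lemma clip_mul_soft_threshold (R : realType) (l u : R) : 0 < l ->
  clip l u * soft_threshold u l = l * `|soft_threshold u l|.
Proof.
move=> l0; rewrite soft_threshold_clip // /clip.
case: ifP => h1; first by rewrite gtr0_norm ?subr_gt0.
case: ifP => h2; first by rewrite ltr0_norm ?subr_lt0 // mulrN mulNr.
by rewrite subrr normr0 !mulr0.
Qed.

(** If the inner clip saturates, adding [u] of the same sign keeps the sum at or beyond the bound,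
    so both sides sit at that bound. Opposite signs would break this. *)
Lemma clip_clipD (R : realType) (l t u : R) : 0 < l ->
  (0 <= t) && (0 <= u) || (t <= 0) && (u <= 0) ->
  clip l (u + clip l t) = clip l (u + t).
Proof.
move=> l0 /orP[] /andP[? ?]; rewrite [clip l t]/clip; do ?[case: ifP => ?];
  rewrite /clip; do ?[case: ifP => ?]; lra.
Qed.

(** Quadratic growth from strong convexity: after expanding, the claim is the subgradient inequality
    [wb]. It yields minimality and uniqueness at once. *)
Lemma soft_threshold_prox (R : realType) (l u b : R) : 0 < l ->
  let c := soft_threshold u l in
  2^-1 * (b - c) ^+ 2 <=
  (2^-1 * b ^+ 2 - u * b + l * `|b|) - (2^-1 * c ^+ 2 - u * c + l * `|c|).
Proof.
move=> l0 /=; set c := soft_threshold u l.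
have cE : clip l u * c = l * `|c| by exact: clip_mul_soft_threshold.
have wb : clip l u * b <= l * `|b|.
  apply: le_trans (ler_norm _) _; rewrite normrM.
  by apply: ler_wpM2r; rewrite ?normr_ge0 ?clip_norm_le.
have uE : u = c + clip l u by rewrite /c soft_threshold_clip // subrK.
rewrite -cE; move: wb; rewrite {2 3}uE; nra.
Qed.

(** Terms free of the argument cancel in the difference, leaving separate scalar problems. *)
Lemma bregman_objectiveB (R : realType) (p : nat) (l : R)
    (y rho w b c : 'rV[R]_p) :
  bregman_objective l y rho w b - bregman_objective l y rho w c =
  \sum_(i < p)
    let u := y ord0 i + l * rho ord0 i in
    ((2^-1 * b ord0 i ^+ 2 - u * b ord0 i + l * `|b ord0 i|) -
     (2^-1 * c ord0 i ^+ 2 - u * c ord0 i + l * `|c ord0 i|)).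
Proof.
have sumE x : bregman_objective l y rho w x = \sum_(i < p)
   (2^-1 * (y ord0 i - x ord0 i) ^+ 2 + l * (`|x ord0 i| - `|w ord0 i| -
     rho ord0 i * (x ord0 i - w ord0 i))).
  rewrite /bregman_objective /l2norm sqr_sqrtr; last first.
    by apply: sumr_ge0 => i _; exact: sqr_ge0.
  rewrite /bregman_div /l1norm /dotv big_split /= -!mulr_sumr !sumrB.
  congr (_ * _ + _ * (_ - _)); first by apply: eq_bigr => i _; rewrite !mxE.
  by apply: eq_bigr => i _; rewrite !mxE.
by rewrite !sumE -sumrB; apply: eq_bigr => i _ /=; field.
Qed.

Lemma bregman_argmin (R : realType) (p : nat) (l : R)
    (y rho w b : 'rV[R]_p) (j : 'I_p) : 0 < l ->
  is_argmin (bregman_objective l y rho w) b ->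
  b ord0 j = soft_threshold (y ord0 j + l * rho ord0 j) l.
Proof.
move=> l0 bmin.
pose c : 'rV[R]_p := \row_i soft_threshold (y ord0 i + l * rho ord0 i) l.
have ge0 i : true -> 0 <= 2^-1 * (b ord0 i - c ord0 i) ^+ 2.
  by move=> _; rewrite mulr_ge0 ?invr_ge0 ?sqr_ge0.
(* Growth around [c] bounds this sum by the objective gap between [b] and [c], which is nonpositive
   by minimality of [b]. *)
have sum0 : \sum_i 2^-1 * (b ord0 i - c ord0 i) ^+ 2 = 0.
  apply/le_anti/andP; split; last exact: sumr_ge0.
  have := bmin c; rewrite -subr_le0 bregman_objectiveB; apply: le_trans.
  by apply: ler_sum => i _; rewrite mxE; exact: soft_threshold_prox.
have /eqP := psumr_eq0P ge0 sum0 (erefl : xpredT j).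
rewrite mulf_eq0 invr_eq0 pnatr_eq0 /= expf_eq0 /= subr_eq0 => /eqP ->.
by rewrite mxE.
Qed.

Lemma bregman_subgradient (R : realType) (p : nat) (y : 'rV[R]_p) (l : R)
    (beta rho : nat -> 'rV[R]_p) (k : nat) (j : 'I_p) : 0 < l ->
  bregman_iterations l y beta rho ->
  l * rho k ord0 j = clip l (k%:R * y ord0 j).
Proof.
move=> l0 [_ rho0 step]; elim: k => [|k IHk].
  by rewrite rho0 mxE mulr0 mul0r /clip oppr_gt0 !ltNge (ltW l0).
have [bmin ->] := step k.
rewrite !mxE (bregman_argmin _ _ bmin) // soft_threshold_clip // mulrDr.
(* The sign condition holds because [k%:R * y] and [y] never have opposite signs. *)
rewrite mulVKf ?gt_eqF // IHk clip_clipD //; last first.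
  have [y0|/ltW y0] := leP 0 (y ord0 j).
    by rewrite mulr_ge0.
  by rewrite y0 mulr_ge0_le0 ?orbT.
by rewrite -natr1 mulrDl mul1r [k%:R * _ + _]addrC; ring.
Qed.

Lemma soft_thresholdZ (R : realType) (a u l : R) :
  0 < a -> soft_threshold (a * u) l = a * soft_threshold u (l / a).
Proof.
move=> a0; rewrite /soft_threshold sgrM gtr0_sg // mul1r mulrCA.
rewrite (maxr_pMr _ _ (ltW a0)) mulr0 mulrBr mulrCA divff ?gt_eqF // mulr1.
by rewrite normrM gtr0_norm.
Qed.

Theorem proposition8 (R : realType) (p : nat) (y : 'rV[R]_p) (lambda : R)
    (hlambda : 0 < lambda) (beta rho : nat -> 'rV[R]_p)
    (hB : bregman_iterations lambda y beta rho)
    (k : nat) (hk : (0 < k)%N) (j : 'I_p) :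
  beta k.+1 ord0 j =
    firm_threshold y (lambda / k.+1%:R) (k.+1%:R / k%:R) ord0 j /\
  firm_threshold y (lambda / k.+1%:R) (k.+1%:R / k%:R) ord0 j =
    (if `|y ord0 j| <= lambda / k%:R
     then k.+1%:R * soft_threshold (y ord0 j) (lambda / k.+1%:R)
     else y ord0 j).
Proof.
have k0 : 0 < k%:R :> R by rewrite ltr0n.
have FT : firm_threshold y (lambda / k.+1%:R) (k.+1%:R / k%:R) ord0 j =
    (if `|y ord0 j| <= lambda / k%:R
     then k.+1%:R * soft_threshold (y ord0 j) (lambda / k.+1%:R)
     else y ord0 j).
  rewrite mxE mulrA mulfVK ?pnatr_eq0 //.
  (* Here gamma - 1 = 1/k. *)
  have -> // : k.+1%:R / k%:R / (k.+1%:R / k%:R - 1) = k.+1%:R :> R.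
  rewrite -{2}natr1 mulrDl divff ?gt_eqF // addrAC subrr add0r mul1r invrK.
  by rewrite mulfVK ?gt_eqF.
split=> //; rewrite FT.
have [_ _ /(_ k)[bmin _]] := hB.
rewrite (bregman_argmin _ _ bmin) // (bregman_subgradient k j hlambda hB) //.
have [yl|yl] := leP.
  (* In this range the clip is still inactive. *)
  have ->: y ord0 j + clip lambda (k%:R * y ord0 j) = k.+1%:R * y ord0 j.
    have : `|k%:R * y ord0 j| <= lambda.
      by rewrite normrM gtr0_norm // mulrC -ler_pdivlMr.
    rewrite ler_norml -natr1 /clip => /andP[? ?].
    by do ?[case: ifP => ?]; lra.
  by rewrite soft_thresholdZ.
(* Now the clip has saturated: the step adds [lambda] with the sign of [y ord0 j], and thresholding
   removes exactly that. *)
have yl' : lambda < k%:R * `|y ord0 j| by rewrite mulrC -ltr_pdivrMr.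
rewrite soft_threshold_clip //.
case: (ltrgt0P (y ord0 j)) yl' => [y0|y0|->]; rewrite ?mulr0; last lra.
  by move=> ylt; rewrite /clip; do ?[case: ifP => ?]; lra.
by move=> ylt; rewrite /clip; do ?[case: ifP => ?]; lra.
Qed.
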